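(* For the 2-server problem on the metric consisting of three equidistant collinear points, for a suitable initial configuration of the servers, every deterministic online algorithm has strict bijective ratio at least $2$ against the optimal offline algorithm.
   Context: Metric: three points $1,2,3$ on a line with distance $d>0$ between consecutive points. Two servers occupy points; each request is a point, to which an algorithm must move a server; cost is the total distance moved. The online algorithm and the optimal offline algorithm $\textsc{opt}$ start from the same initial configuration. $\mathcal{I}_n$ is the set of all request sequences of length $n$. The strict bijective ratio of an online algorithm $A$ against $B$ is at most $\rho$ if there is $n_0$ such that for all $n\ge n_0$ there exists a bijection $\pi:\mathcal{I}_n\to\mathcal{I}_n$ with $A(\sigma)\le\rho\cdot B(\pi(\sigma))$ for all $\sigma\in\mathcal{I}_n$; the ratio is the infimum of such $\rho$. *)

(* Defs.v *)
From HB Require Import structures.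
From mathcomp Require Import all_boot all_order all_algebra.
From mathcomp Require Import all_classical all_reals all_analysis.

Set Implicit Arguments.
Unset Strict Implicit.
Unset Printing Implicit Defensive.

Import Order.TTheory GRing.Theory Num.Theory.
Local Open Scope classical_set_scope.
Local Open Scope ring_scope.

(* Servers are labelled by 'I_k and may share a point. *)
Notation config T k := {ffun 'I_k -> T}.

Definition serves (T : finType) (k : nat) (c : config T k) (r : T) : bool :=
  [exists i : 'I_k, c i == r].

Definition move_cost (R : realType) (T : finType) (dist : T -> T -> R)
    (k : nat) (c c' : config T k) : R :=
  \sum_(i < k) dist (c i) (c' i).

(* A schedule lists the configurations reached after each successive request;
   [c] is the configuration before the first request. *)
Fixpoint schedule_cost (R : realType) (T : finType) (dist : T -> T -> R)
    (k : nat) (c : config T k) (s : seq (config T k)) : R :=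
  if s is c' :: s' then move_cost dist c c' + schedule_cost dist c' s' else 0.

(* [all2] also requires the two sequences to have the same length. *)
Definition feasible (T : finType) (k : nat)
    (s : seq (config T k)) (sigma : seq T) : bool :=
  all2 (@serves T k) s sigma.

(* A deterministic online algorithm: its configuration is a function of the
   requests revealed so far. *)
Record online_alg (T : finType) (k : nat) (c0 : config T k) := OnlineAlg {
  alg_config :> seq T -> config T k;
  alg_init : alg_config [::] = c0;
  alg_serves : forall (h : seq T) (r : T), serves (alg_config (rcons h r)) r
}.

Definition online_schedule (T : finType) (k : nat) (c0 : config T k)
    (A : online_alg c0) (sigma : seq T) : seq (config T k) :=
  [seq A (take t.+1 sigma) | t <- iota 0 (size sigma)].

Definition online_cost (R : realType) (T : finType) (dist : T -> T -> R)
    (k : nat) (c0 : config T k) (A : online_alg c0) (sigma : seq T) : R :=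
  schedule_cost dist c0 (online_schedule A sigma).

(* For k > 0 the infimum is over a finite nonempty set, hence a minimum. *)
Definition opt_cost (R : realType) (T : finType) (dist : T -> T -> R)
    (k : nat) (c0 : config T k) (sigma : seq T) : R :=
  inf [set schedule_cost dist c0 s | s in [set s | feasible s sigma]].

Definition strict_bijective_bound (R : realType) (T : finType)
    (costA costB : seq T -> R) (rho : R) : Prop :=
  exists n0 : nat, forall n : nat, (n0 <= n)%N ->
    exists pi : n.-tuple T -> n.-tuple T,
      bijective pi /\
      forall sigma : n.-tuple T, costA sigma <= rho * costB (pi sigma).

(* Extended-real valued, so that the ratio is +oo when no rho is a bound. *)
Definition strict_bijective_ratio (R : realType) (T : finType)
    (costA costB : seq T -> R) : \bar R :=
  ereal_inf [set rho%:E | rho in strict_bijective_bound costA costB].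

(* The points 1, 2, 3 are the elements 0, 1, 2 of 'I_3. *)
Definition line3_dist (R : realType) (d : R) (x y : 'I_3) : R :=
  d * `|(x : nat)%:R - (y : nat)%:R : R|.

(* Main.v *)
(* Start from the configuration {1,3} and take d as the unit of cost, so that
   all costs are integers.  If the ratio were less than 2, the bijection would
   send every sequence outside {A <= 1} outside {OPT <= 1}.  But {A <= 1} is
   contained in {OPT <= 1}, so by finiteness the two sets would coincide.  They
   do not: OPT pays 1 on both 2,1,1,... and 2,3,3,..., whereas A has committed
   itself after the first request and pays at least 2 on one of them. *)
Require Import Defs.
From mathcomp Require Import all_boot all_order all_algebra.
From mathcomp Require Import all_classical all_reals all_analysis.
From mathcomp Require Import zify.

Import Order.TTheory GRing.Theory Num.Theory.
Local Open Scope ring_scope.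

Section Schedules.
Variables (R : realType) (T : finType) (k : nat).
Variable dist : T -> T -> R.
Hypothesis dist_ge0 : forall x y, 0 <= dist x y.
Implicit Types (c : {ffun 'I_k -> T}) (s : seq {ffun 'I_k -> T}).

Lemma schedule_cost_ge0 c s : 0 <= schedule_cost dist c s.
Proof.
elim: s c => //= c' s IHs c.
by rewrite addr_ge0 // /move_cost sumr_ge0.
Qed.

Lemma opt_cost_le c s (sigma : seq T) :
  feasible s sigma -> opt_cost dist c sigma <= schedule_cost dist c s.
Proof.
move=> fs; apply: ge_inf; last by exists s.
by exists 0 => _ [s' _ <-]; exact: schedule_cost_ge0.
Qed.

Lemma opt_cost_ge0 c (sigma : seq T) : 0 <= opt_cost dist c sigma.
Proof.
rewrite /opt_cost; set E := (X in inf X).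
(* With no feasible schedule the infimum takes its default value 0, so no assumption on [k] is
   needed here. *)
have [->|E0] := eqVneq E classical_sets.set0; first by rewrite inf0.
apply: lb_le_inf; first exact/classical_sets.set0P.
by move=> _ [s _ <-]; exact: schedule_cost_ge0.
Qed.

Lemma online_schedule_feasible c (A : online_alg c) (sigma : seq T) :
  feasible (online_schedule A sigma) sigma.
Proof.
rewrite /feasible /online_schedule.
(* Generalise over the history [h] already revealed: the configurations of [A] depend on all past
   requests, so the induction must carry them along. *)
suff H h : all2 (@serves T k)
    [seq A (h ++ take t.+1 sigma) | t <- iota 0 (size sigma)] sigma.
  exact: (H [::]).
elim: sigma h => //= r sigma IH h.
rewrite take0 cats1 alg_serves /= (iotaDl 1 0) -map_comp.
have := IH (rcons h r); congr (all2 _ _ _).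
by apply: eq_map => t /=; rewrite cat_rcons.
Qed.

Lemma opt_le_online c (A : online_alg c) (sigma : seq T) :
  opt_cost dist c sigma <= online_cost dist A sigma.
Proof. exact/opt_cost_le/online_schedule_feasible. Qed.

Lemma online_cost_ge2 c (A : online_alg c) (r1 r2 : T) (sigma : seq T) :
  move_cost dist c (A [:: r1]) + move_cost dist (A [:: r1]) (A [:: r1; r2])
    <= online_cost dist A [:: r1, r2 & sigma].
Proof.
rewrite /online_cost /online_schedule /= take0 addrA lerDl.
exact: schedule_cost_ge0.
Qed.

End Schedules.

Section Line3.
Variables (R : realType) (d : R).
Implicit Types (c : {ffun 'I_2 -> 'I_3}) (x y : 'I_3).

Lemma line3_dist_ge0 x y : 0 <= d -> 0 <= line3_dist d x y.
Proof. by move=> d0; rewrite mulr_ge0. Qed.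

(* One of the two truncated differences vanishes. *)
Lemma line3_distE x y : line3_dist d x y = d * (x - y + (y - x))%:R.
Proof.
rewrite /line3_dist; congr (_ * _).
wlog le_xy : x y / (x <= y)%N => [H|].
  by case/orP: (leq_total x y) => /H // Hyx; rewrite distrC Hyx addnC.
have -> : (x - y = 0)%N by apply/eqP.
by rewrite distrC -natrB // ger0_norm.
Qed.

(** Move cost in units of [d], kept in [nat] with truncated subtractions so that [lia] can settle
    the case analysis on configurations. *)
Definition steps c c' : nat :=
  (c ord0 - c' ord0 + (c' ord0 - c ord0)
   + (c ord_max - c' ord_max + (c' ord_max - c ord_max)))%N.

Lemma move_cost_steps c c' : move_cost (line3_dist d) c c' = d * (steps c c')%:R.
Proof.
rewrite /move_cost big_ord_recl big_ord1 !line3_distE -mulrDr -natrD.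
by rewrite (_ : lift ord0 ord0 = ord_max) //; apply: val_inj.
Qed.

(** Integrality is what turns a cost strictly below [2 * d] into one of at most [d]. *)
Lemma schedule_cost_integral c (s : seq {ffun 'I_2 -> 'I_3}) :
  exists m : nat, schedule_cost (line3_dist d) c s = d * m%:R.
Proof.
elim: s c => [|c' s IHs] c /=; first by exists 0; rewrite mulr0.
have [m ->] := IHs c'; exists (steps c c' + m)%N.
by rewrite move_cost_steps natrD mulrDr.
Qed.

Lemma servesP2 c x : serves c x -> c ord0 = x \/ c ord_max = x.
Proof.
case/existsP => -[[|[|//]] i2] /eqP <-; [left|right]; congr (c _);
  exact: val_inj.
Qed.

End Line3.

Definition conf (x y : 'I_3) : {ffun 'I_2 -> 'I_3} :=
  [ffun i => if i == ord0 then x else y].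

Definition left_pt : 'I_3 := inord 0.
Definition mid_pt : 'I_3 := inord 1.
Definition right_pt : 'I_3 := inord 2.

Lemma left_ptE : left_pt = 0%N :> nat. Proof. exact: inordK. Qed.
Lemma mid_ptE : mid_pt = 1%N :> nat. Proof. exact: inordK. Qed.
Lemma right_ptE : right_pt = 2%N :> nat. Proof. exact: inordK. Qed.

Notation start := (conf left_pt right_pt).

(** Serving the middle takes at least one step. If it takes exactly one, a single server has left
    its end point, and a request at that vacated end forces a second step. *)
Lemma two_steps_somewhere (c1 cl cr : {ffun 'I_2 -> 'I_3}) :
  serves c1 mid_pt -> serves cl left_pt -> serves cr right_pt ->
  (2 <= steps start c1 + steps c1 cl)%N \/ (2 <= steps start c1 + steps c1 cr)%N.
Proof.
rewrite /steps !ffunE /= left_ptE right_ptE => /servesP2 H1 /servesP2 Hl /servesP2 Hr.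
have {}H1 : c1 ord0 = 1%N :> nat \/ c1 ord_max = 1%N :> nat.
  by case: H1 => ->; [left|right]; exact: mid_ptE.
have {}Hl : cl ord0 = 0%N :> nat \/ cl ord_max = 0%N :> nat.
  by case: Hl => ->; [left|right]; exact: left_ptE.
have {}Hr : cr ord0 = 2%N :> nat \/ cr ord_max = 2%N :> nat.
  by case: Hr => ->; [left|right]; exact: right_ptE.
lia.
Qed.

Section LowerBound.
Variables (R : realType) (d : R).
Hypothesis d_gt0 : 0 < d.
Let dist := line3_dist d.

Let dist_ge0 x y : 0 <= dist x y.
Proof. exact/line3_dist_ge0/ltW. Qed.

(** The offline schedule moves to [c] at the first request and never moves again. *)
Lemma opt_cost_commit c (x : 'I_3) m :
  serves c mid_pt -> serves c x -> steps start c = 1%N ->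
  opt_cost dist start [:: mid_pt, x & nseq m x] <= d.
Proof.
move=> cm cx st1.
have /(opt_cost_le _ _ _ _ dist_ge0 start) /le_trans -> // :
    feasible (nseq m.+2 c) [:: mid_pt, x & nseq m x].
  by rewrite /feasible /= cm cx /=; elim: m => //= m ->; rewrite cx.
have stay p : schedule_cost dist c (nseq p c) = 0.
  elim: p => //= p ->; rewrite move_cost_steps.
  by rewrite /steps !subnn mulr0 addr0.
rewrite -[leLHS]/(move_cost dist start c + schedule_cost dist c (nseq m.+1 c)).
by rewrite stay addr0 move_cost_steps st1 mulr1.
Qed.

Lemma opt_cheap_online_expensive (A : online_alg start) m :
  exists2 x, opt_cost dist start [:: mid_pt, x & nseq m x] <= d
           & 2 * d <= online_cost dist A [:: mid_pt, x & nseq m x].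
Proof.
have serve0 x y : serves (conf x y) x by apply/existsP; exists ord0; rewrite ffunE.
have serve1 x y : serves (conf x y) y by apply/existsP; exists ord_max; rewrite ffunE.
have exp x : (2 <= steps start (A [:: mid_pt])
                 + steps (A [:: mid_pt]) (A [:: mid_pt; x]))%N ->
    2 * d <= online_cost dist A [:: mid_pt, x & nseq m x].
  move=> H; apply: le_trans (online_cost_ge2 _ _ _ _ dist_ge0 _ _ _ _ _).
  by rewrite !move_cost_steps -mulrDr -natrD mulrC ler_pM2l // ler_nat.
have [H|H] := two_steps_somewhere (A [:: mid_pt]) (A [:: mid_pt; left_pt])
  (A [:: mid_pt; right_pt]) (alg_serves A [::] _) (alg_serves A [:: _] _)
  (alg_serves A [:: _] _).
- exists left_pt; last exact: exp.
  (* Knowing that the left end comes next, the offline schedule serves the middle with the right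
     server. *)
  apply: (opt_cost_commit (conf left_pt mid_pt)) => //.
  by rewrite /steps !ffunE /= left_ptE mid_ptE right_ptE.
- exists right_pt; last exact: exp.
  apply: (opt_cost_commit (conf mid_pt right_pt)) => //.
  by rewrite /steps !ffunE /= left_ptE mid_ptE right_ptE.
Qed.

Lemma strict_bijective_bound_ge2 (A : online_alg start) rho :
  strict_bijective_bound (online_cost dist A) (opt_cost dist start) rho ->
  2 <= rho.
Proof.
(* Length [n0.+2] leaves room for the two decisive requests, followed by [n0] repetitions. *)
case=> n0 /(_ n0.+2 (leqW (leqnSn n0))) [pi [pi_bij pi_le]].
rewrite leNgt; apply/negP => rho2.
have [x optx onx] := opt_cheap_online_expensive A n0.
pose cheapO := [set s : n0.+2.-tuple 'I_3 | opt_cost dist start s <= d].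
pose cheapA := [set s : n0.+2.-tuple 'I_3 | online_cost dist A s <= d].
have sub1 : pi @^-1: cheapO \subset cheapA.
  apply/fintype.subsetP => s; rewrite !inE => opts.
  have : online_cost dist A s < 2 * d.
    apply: le_lt_trans (pi_le s) _.
    have opt0 := opt_cost_ge0 _ _ _ _ dist_ge0 start (pi s).
    (* Nothing forces [rho] to be nonnegative; for a negative one the product with the optimal cost
       is at most 0, hence below [2 * d]. *)
    have [rho0|rho0] := leP 0 rho.
      by rewrite (@le_lt_trans _ _ (rho * d)) ?ler_wpM2l ?ltr_pM2r.
    by apply: (@le_lt_trans _ _ 0); rewrite ?mulr_gt0 // mulr_le0_ge0 // ltW.
  rewrite /online_cost.
  have [m ->] := schedule_cost_integral R d start (online_schedule A s).
  by rewrite mulrC ltr_pM2r // ltr_nat ltnS ger_pMl // lern1.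
have sub2 : cheapA \proper cheapO.
  apply/properP; split.
    apply/fintype.subsetP => s; rewrite !inE; apply: le_trans.
    exact: opt_le_online.
  exists [tuple of [:: mid_pt, x & nseq n0 x]]; rewrite !inE //= -ltNge.
  by apply: lt_le_trans onx; rewrite mulr_natl mulr2n ltrDl.
(* A preimage under a bijection keeps its cardinality, so [cheapO] would be strictly smaller than
   itself. *)
have := leq_ltn_trans (subset_leq_card sub1) (proper_card sub2).
by rewrite on_card_preimset ?ltnn //; exact: onW_bij.
Qed.

End LowerBound.

Theorem theorem6 (R : realType) (d : R) (hd : 0 < d) :
  exists c0 : {ffun 'I_2 -> 'I_3},
    forall A : online_alg c0,
      (2%:E <= strict_bijective_ratio (online_cost (line3_dist d) A)
                                      (opt_cost (line3_dist d) c0))%E.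
Proof.
exists start => A; apply: le_ereal_inf_tmp => _ [rho bound <-].
by rewrite lee_fin (strict_bijective_bound_ge2 _ _ hd A).
Qed.
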